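(* Let $G$ be a distance-regular graph of positive diameter. Then for every root $a\in V(G)$ the vertex-deleted graph $G-a$ is connected. If moreover the diameter of $G$ is at most two, then for every $a$ the punctured algebra equals the compressed Terwilliger algebra: $\mathcal B_a=e\mathcal T(a)e$. In particular, this equality holds for every connected nontrivial strongly regular graph.
   Context: All graphs are finite and simple; all algebras are over $\mathbb R$; $\langle\cdots\rangle$ denotes the real unital algebra generated. $A$ is the adjacency matrix of $G$. For a root $a$ of eccentricity $D$, $E_i^*$ is the diagonal projection of $\mathbb R^{V(G)}$ onto the vertices at distance $i$ from $a$, and $\mathcal T(a)=\langle A,E_0^*,\ldots,E_D^*\rangle$ is the Terwilliger algebra. Put $e=I-E_0^*$; the corner $e\mathcal T(a)e$ is identified with an algebra of operators on $\mathbb R^{V(G)\setminus\{a\}}$. $B=A(G-a)$ is the adjacency matrix of the vertex-deleted graph, $E$ is the diagonal matrix indexed by $V(G)\setminus\{a\}$ whose diagonal is the indicator of the neighbourhood $N(a)$, and $\mathcal B_a=\langle I,B,E\rangle$ is the punctured (adjacency--degree) algebra. ''Nontrivial'' strongly regular means neither complete nor edgeless. *)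

(* Defs.v *)
From HB Require Import structures.
From mathcomp Require Import all_boot all_order all_algebra.
From mathcomp Require Import classical_sets reals.

Set Implicit Arguments.
Unset Strict Implicit.
Unset Printing Implicit Defensive.

Import GRing.Theory.
Local Open Scope ring_scope.

Record sgraph := SGraph {
  vertex :> finType;
  adj : rel vertex;
  adj_sym : symmetric adj;
  adj_irr : irreflexive adj }.

Section Graphs.
Local Open Scope nat_scope.
Variable G : sgraph.

(* The empty graph does not count as connected. *)
Definition connected_graph : Prop :=
  0 < #|G| /\ forall x y : G, connect (@adj G) x y.

Definition walk (n : nat) (x y : G) : bool :=
  [exists p : n.-tuple G, path (@adj G) x p && (last x p == y)].

(* Least length of a walk from x to y; vertices in different components get
   the value #|G|, which is never a genuine distance. *)
Definition dist (x y : G) : nat :=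
  find (fun n => walk n x y) (iota 0 #|G|).

Definition ecc (a : G) : nat := \max_(x : G) dist a x.
Definition diameter : nat := \max_(a : G) ecc a.

(* b i and c i are the intersection numbers b_i and c_i. The remaining
   a_i = b_0 - b_i - c_i is then constant too: the case x = y says that G is
   regular of valency b 0. *)
Definition distance_regular : Prop :=
  connected_graph /\
  exists b c : nat -> nat, forall x y : G,
    #|[set z | adj y z & dist x z == (dist x y).+1]%SET| = b (dist x y) /\
    #|[set z | adj y z & (dist x z).+1 == dist x y]%SET| = c (dist x y).

Definition strongly_regular : Prop :=
  exists k l m : nat,
    [/\ forall x : G, #|[set z | adj x z]%SET| = k,
        forall x y : G, adj x y -> #|[set z | adj x z & adj y z]%SET| = l
      & forall x y : G, x != y -> ~~ adj x y ->
          #|[set z | adj x z & adj y z]%SET| = m].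

Definition complete_graph : Prop := forall x y : G, x != y -> adj x y.
Definition edgeless_graph : Prop := forall x y : G, ~~ adj x y.

Variable a : G.

Definition del_adj : rel {x : G | x != a} := relpre val (@adj G).

Lemma del_adj_sym : symmetric del_adj.
Proof. by move=> x y; apply: adj_sym. Qed.

Lemma del_adj_irr : irreflexive del_adj.
Proof. by move=> x; apply: adj_irr. Qed.

Definition del_vertex : sgraph := SGraph del_adj_sym del_adj_irr.

End Graphs.

(* Matrices indexed by a finite type T are realised in 'M_#|T| through the
   enumeration of T. *)
Section IndexedMatrices.
Variables (R : realType) (T : finType).

Definition mx_of (f : T -> T -> R) : 'M[R]_#|T| :=
  \matrix_(i, j) f (enum_val i) (enum_val j).

Definition entry (M : 'M[R]_#|T|) (x y : T) : R :=
  M (enum_rank x) (enum_rank y).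

Definition diag_proj (P : pred T) : 'M[R]_#|T| :=
  mx_of (fun x y => ((x == y) && P x)%:R).

End IndexedMatrices.

Section GeneratedAlgebra.
Variables (R : realType) (n : nat).

Definition unital_subalgebra (S : set 'M[R]_n) : Prop :=
  [/\ S 1%:M,
      forall (c : R) (X Y : 'M[R]_n), S X -> S Y -> S (c *: X + Y)
    & forall X Y : 'M[R]_n, S X -> S Y -> S (X *m Y)].

Definition gen_algebra (gens : set 'M[R]_n) : set 'M[R]_n :=
  smallest unital_subalgebra gens.

End GeneratedAlgebra.

Section Algebras.
Local Open Scope classical_set_scope.
Variables (R : realType) (G : sgraph).

Definition adj_mx : 'M[R]_#|G| := mx_of (fun x y => (adj x y)%:R).

Variable a : G.

Definition dual_idem (i : nat) : 'M[R]_#|G| :=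
  diag_proj R (fun x => dist a x == i).

Definition terwilliger : set 'M[R]_#|G| :=
  gen_algebra (adj_mx |` [set dual_idem i | i in [set i | (i <= ecc a)%N]]).

Definition corner_idem : 'M[R]_#|G| := 1%:M - dual_idem 0.

(* Identifies the operators X = e X e with operators on the space of functions
   on the vertices other than a, by deleting the zero row and column at a. *)
Definition delete_mx (M : 'M[R]_#|G|) : 'M[R]_#|del_vertex a| :=
  mx_of (fun x y : del_vertex a => entry M (val x) (val y)).

Definition compressed_terwilliger : set 'M[R]_#|del_vertex a| :=
  delete_mx @` [set corner_idem *m X *m corner_idem | X in terwilliger].

End Algebras.

Arguments terwilliger R {G} a.
Arguments compressed_terwilliger R {G} a.

Section Punctured.
Local Open Scope classical_set_scope.
Variables (R : realType) (G : sgraph) (a : G).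

Definition nbr_proj : 'M[R]_#|del_vertex a| :=
  diag_proj R (fun x : del_vertex a => adj a (val x)).

Definition punctured_algebra : set 'M[R]_#|del_vertex a| :=
  gen_algebra [set 1%:M; adj_mx R (del_vertex a); nbr_proj].

End Punctured.

Arguments punctured_algebra R {G} a.

(* Main.v *)
Require Import Defs.
From mathcomp Require Import all_boot all_order all_algebra.
From mathcomp Require Import classical_sets reals.
From mathcomp Require Import ring.

Set Implicit Arguments.
Unset Strict Implicit.
Unset Printing Implicit Defensive.

Import GRing.Theory Num.Theory.

(** Connectivity of G - a uses one symmetry of the intersection numbers: the
    number b_i computed from the pair (x, y) is the one computed from (y, x).
    Let x0 be a vertex farthest from a in its component of G - a, at distance
    i from a.  No neighbour of x0 is at distance i + 1 from a, so b_i = 0;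
    read from the other end, no neighbour of a is at distance i + 1 from x0.
    A geodesic from x0 to a neighbour z of a thus has length at most i, too
    short to pass through a on its way to z, so every neighbour of a lies in
    the component of x0.  As every vertex is joined in G - a to some neighbour
    of a, there is only one component ([del_vertex_connected]).

    For the algebras, a distance-regular graph of diameter at most two is
    strongly regular, and a connected strongly regular graph has diameter at
    most two, so both claims follow from the case of a connected strongly
    regular graph of diameter at most two ([punctured_eq_compressed]).  That
    the punctured algebra is contained in the compressed one is immediate.
    The converse rests on the fact that the all-ones matrix J lies in the
    punctured algebra ([punctured_all_ones]).  Deleting a from the identity
    A^2 = k I + l A + m (J - I - A) gives
      B^2 - (k - m) I - (l - m) B = m J - E J E,
    and multiplying by F = I - E on either side kills the last term, so F J
    and J F are in the algebra when m is nonzero; their product (J F)(F J) is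
    a multiple of J, nonzero as soon as a has a non-neighbour.  These two
    conditions fail only for complete graphs, where J = I + B.

    Given J, consider the matrices M on G such that the three matrices on
    G - a built from M, namely its block off a, the row of a repeated in every
    row, and the column of a repeated in every column, all lie in the punctured
    algebra ([bordered]).  They form an algebra: a path from x to y through a
    contributes column times row, and the product of the two repeated matrices
    is that contribution times the number of vertices of G - a.  This algebra
    contains the generators of the Terwilliger algebra, since the row of a in A
    is the row of J E, and the diagonal projections have no entries joining a
    to G - a.  Hence it contains the whole Terwilliger algebra. *)

(** * Walks and distances *)

Section Distance.
Variable G : sgraph.
Implicit Types x y z a : G.

Lemma walkP n x y :
  reflect (exists p : seq G, [/\ size p = n, path (@adj G) x p & last x p = y])
          (walk n x y).
Proof.
apply: (iffP existsP) => [[p /andP[xp /eqP py]]|[p [sz xp py]]].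
  by exists p; rewrite size_tuple.
by exists (tcast sz (in_tuple p)); rewrite val_tcast xp py /=.
Qed.

Lemma walk_cat m n x y z : walk m x y -> walk n y z -> walk (m + n) x z.
Proof.
move=> /walkP[p [<- xp py]] /walkP[q [<- yq qz]]; apply/walkP.
by exists (p ++ q); rewrite size_cat cat_path last_cat xp py.
Qed.

Lemma walk1 x y : walk 1 x y = adj x y.
Proof.
apply/walkP/idP => [[[|z [|u p]] [//= _ /andP[xz _] <-]] //|xy].
by exists [:: y]; rewrite /= xy.
Qed.

Lemma walk_sym n x y : walk n x y -> walk n y x.
Proof.
elim: n x => [|n IH] x.
  by move=> /walkP[[|u p] [//= _ _ <-]]; apply/walkP; exists [::].
move=> /walkP[[|z p] [//= [sz] /andP[xz zp] py]].
rewrite -addn1; apply: (@walk_cat n 1 y z x).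
  by apply: IH; apply/walkP; exists p.
by rewrite walk1 adj_sym.
Qed.

Lemma dist_le_walk n x y : walk n x y -> dist x y <= n.
Proof.
move=> w; rewrite /dist; have [nG|Gn] := ltnP n #|G|; last first.
  by rewrite (leq_trans (find_size _ _)) // size_iota.
rewrite leqNgt; apply/negP => /(before_find 0).
by rewrite nth_iota // add0n w.
Qed.

Lemma walk_dist x y : connect (@adj G) x y -> walk (dist x y) x y.
Proof.
move=> /connectP[p0 xp0 ->]; case/shortenP: xp0 => p xp up _.
have w : walk (size p) x (last x p) by apply/walkP; exists p.
have hw : has (fun n => walk n x (last x p)) (iota 0 #|G|).
  apply/hasP; exists (size p) => //; rewrite mem_iota /=.
  by have := max_card (mem (x :: p)); rewrite (card_uniqP up).
have := nth_find 0 hw; rewrite nth_iota //.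
by move: hw; rewrite has_find size_iota.
Qed.

Lemma dist_gt0 x y : (0 < dist x y) = (x != y).
Proof.
apply/idP/idP => [|xy].
  apply: contraTneq => <-; rewrite -leqNgt; apply: dist_le_walk.
  by apply/walkP; exists [::].
rewrite /dist; have : 0 < #|G| by apply/card_gt0P; exists x.
case: #|G| => //= n _; case: ifP => // /walkP[[|u p] [//= _ _ e]].
by rewrite e eqxx in xy.
Qed.

Lemma dist_eq0 x y : (dist x y == 0) = (x == y).
Proof. by rewrite -[_ == 0]negbK -lt0n dist_gt0 negbK. Qed.

Lemma distxx x : dist x x = 0.
Proof. by apply/eqP; rewrite dist_eq0. Qed.

Lemma dist_adj x y : adj x y -> dist x y = 1.
Proof.
move=> xy; apply/eqP; rewrite eqn_leq dist_le_walk ?walk1 // dist_gt0.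
by apply: contraTneq xy => ->; rewrite adj_irr.
Qed.

Hypothesis Gc : connected_graph G.

Lemma walk_dist_connected x y : walk (dist x y) x y.
Proof. by apply: walk_dist; case: Gc. Qed.

Lemma dist_eq1 x y : (dist x y == 1) = adj x y.
Proof.
apply/eqP/idP => [d1|/dist_adj //].
by rewrite -walk1 -d1 walk_dist_connected.
Qed.

Lemma dist_sym x y : dist x y = dist y x.
Proof.
by apply/eqP; rewrite eqn_leq !dist_le_walk //; apply: walk_sym;
  apply: walk_dist_connected.
Qed.

Lemma dist_adj_le x y z : adj y z -> dist x z <= (dist x y).+1.
Proof.
move=> yz; rewrite -addn1; apply: dist_le_walk.
by apply: walk_cat (walk_dist_connected x y) _; rewrite walk1.
Qed.

End Distance.

Lemma dist_le_ecc (G : sgraph) (x y : G) : dist x y <= ecc x.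
Proof. exact: leq_bigmax. Qed.

Lemma dist_le_diameter (G : sgraph) (x y : G) : dist x y <= diameter G.
Proof. by apply: leq_trans (dist_le_ecc x y) (leq_bigmax x). Qed.

(** * Deleting a vertex of a distance-regular graph *)

Section VertexDeletion.
Variables (G : sgraph) (a : G).
Implicit Types x y : del_vertex a.

Lemma del_vertex_neq x : val x != a.
Proof. by case: x. Qed.

Lemma path_del_vertex x y (p : seq G) :
  path (@adj G) (val x) p -> last (val x) p = val y -> a \notin p ->
  connect (@adj (del_vertex a)) x y.
Proof.
elim: p x => [|z p IH] x /=; first by move=> _ /val_inj->; rewrite connect0.
move=> /andP[xz zp] py; rewrite inE negb_or eq_sym => /andP[za ap].
pose z' : del_vertex a := exist _ z za.
by apply: connect_trans (connect1 _) (IH z' zp py ap).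
Qed.

(** Cut a path from x to a just before it first meets a. *)
Lemma del_vertex_connect_nbr x :
  connected_graph G ->
  exists2 y, adj a (val y) & connect (@adj (del_vertex a)) x y.
Proof.
move=> [_ /(_ (val x) a)/connectP[p]].
elim: p x => [|z p IH] x /=.
  by move=> _ e; have := del_vertex_neq x; rewrite /= -e eqxx.
move=> /andP[xz zp] pa; have [za|za] := eqVneq z a.
  by exists x; rewrite // adj_sym; move: xz; rewrite za.
pose z' : del_vertex a := exist _ z za.
have [y ay z'y] := IH z' zp pa.
by exists y => //; apply: connect_trans (connect1 _) z'y.
Qed.

(** The vertex [far] is farthest from a in the component of x; comparing b_i
    seen from a with b_i seen from [far], where i is their distance, puts every
    neighbour of a in that component. *)
Lemma del_vertex_connected :
  distance_regular G -> 0 < diameter G -> connected_graph (del_vertex a).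
Proof.
move=> [Gc [b [c bc]]] dG; split.
  (* G - a is nonempty: a graph with one vertex has diameter 0. *)
  rewrite /= card_sig -(cardsE (predC1 a)) lt0n; apply/eqP => /cards0_eq e.
  have alla z : z = a.
    by apply/eqP; apply: contraT => za;
      have /finset.setP/(_ z) := e; rewrite !inE za.
  move: dG; rewrite ltnNge => /negP[]; apply/bigmax_leqP => x _.
  apply/bigmax_leqP => y _; rewrite leqn0 dist_eq0.
  by rewrite (alla x) (alla y).
have csym := sym_connect_sym (@adj_sym (del_vertex a)).
suff nbr x z : adj a (val z) -> connect (@adj (del_vertex a)) x z.
  move=> x y; have [z az yz] := del_vertex_connect_nbr y Gc.
  by rewrite (connect_trans (nbr x z az)) // csym.
move=> az.
pose far := [arg max_(u > x in connect (@adj (del_vertex a)) x) dist a (val u)].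
have [xf fmax] : connect (@adj (del_vertex a)) x far /\
    forall u, connect (@adj (del_vertex a)) x u ->
    dist a (val u) <= dist a (val far).
  rewrite /far; case: arg_maxnP => [|u xu umax]; first exact: connect0.
  by split.
have b0 : b (dist a (val far)) = 0.
  rewrite -(bc a (val far)).1; apply/eqP; rewrite cards_eq0.
  apply/eqP/finset.setP => u; rewrite !inE; apply/negP => /andP[fu /eqP du].
  have [ua|ua] := eqVneq u a.
    by move: du; rewrite ua distxx.
  pose u' : del_vertex a := exist _ u ua.
  have fu' : @adj (del_vertex a) far u' by [].
  by have := fmax u' (connect_trans xf (connect1 fu')); rewrite /= du ltnn.
apply: connect_trans xf _.
have dz : dist (val far) (val z) <= dist (val far) a.
  rewrite -ltnS ltn_neqAle dist_adj_le // andbT.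
  move: b0; rewrite dist_sym // -(bc (val far) a).1 => /cards0_eq /finset.setP.
  by move=> /(_ (val z)); rewrite !inE az /= => ->.
(* A walk from far to z through a would reach a after at least dist far a
   steps and still have a step to go. *)
have /walkP[p [sz fp pz]] := walk_dist_connected Gc (val far) (val z).
apply: (path_del_vertex fp pz); apply/negP => pa.
case/path.splitP: pa sz fp pz => p1 p2 sz.
rewrite cat_path last_cat last_rcons => /andP[fp1 ap2] pz.
have : dist (val far) a <= size (rcons p1 a).
  by apply: dist_le_walk; apply/walkP; exists (rcons p1 a); rewrite last_rcons.
rewrite leqNgt => /negP[]; apply: leq_trans dz; rewrite -sz size_cat.
case: p2 pz {sz ap2} => [|u p2] /= pz; last by rewrite addnS ltnS leq_addr.
by have := del_vertex_neq z; rewrite /= -pz eqxx.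
Qed.

End VertexDeletion.

(** * Strongly regular graphs and diameter two *)

Lemma dist_eq2 (G : sgraph) (x y : G) :
  connected_graph G -> diameter G <= 2 -> x != y -> ~~ adj x y -> dist x y = 2.
Proof.
move=> Gc d2 xy nxy; apply/eqP.
rewrite eqn_leq (leq_trans (dist_le_diameter x y)) //.
by rewrite ltn_neqAle eq_sym dist_eq1 // nxy dist_gt0.
Qed.

Lemma common_neighbour (G : sgraph) (x y : G) :
  connected_graph G -> diameter G <= 2 -> x != y -> ~~ adj x y ->
  exists2 z, adj x z & adj y z.
Proof.
move=> Gc d2 xy nxy.
have := walk_dist_connected Gc x y; rewrite dist_eq2 //.
move=> /walkP[[|z [|u [|v p]]] [//= _ /and3P[xz zu _] uy]].
by exists z; rewrite // adj_sym -uy.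
Qed.

(** Here k = b_0, m = c_2, and l is the number a_1 = b_0 - b_1 - 1: the
    neighbours of y other than an adjacent vertex x are at distance 1 or 2
    from x, and b_1 of them are at distance 2. *)
Lemma distance_regular_strongly_regular (G : sgraph) :
  distance_regular G -> diameter G <= 2 -> strongly_regular G.
Proof.
move=> [Gc [b [c bc]]] d2.
have nbr (x : G) : #|[set z | adj x z]%SET| = b 0.
  rewrite -(distxx x) -(bc x x).1 distxx; apply: eq_card => z; rewrite !inE.
  by rewrite dist_eq1 // andbb.
exists (b 0), (b 0 - b 1 - 1), (c 2); split=> // x y.
- move=> xy; have := (bc x y).1; rewrite (dist_adj xy) => <-; rewrite -(nbr y).
  set N := [set z | adj y z]%SET.
  set F := [set z | adj y z & dist x z == 2]%SET.
  have FN : F \subset N by apply/fintype.subsetP => z; rewrite !inE => /andP[].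
  rewrite -(cardsDS FN).
  have xNF : x \in N :\: F by rewrite !inE adj_sym xy distxx andbF.
  rewrite (cardsD1 x (N :\: F)) xNF addKn; apply: eq_card => z.
  rewrite !inE; case yz: (adj y z) => /=; last by rewrite !andbF.
  rewrite !andbT; have [->|zx] := eqVneq z x; first by rewrite adj_irr.
  have := leq_trans (dist_le_diameter x z) d2.
  have : 0 < dist x z by rewrite dist_gt0 eq_sym.
  by rewrite -(dist_eq1 Gc); case: (dist x z) => [|[|[]]].
- move=> xy nxy; have d := dist_eq2 Gc d2 xy nxy.
  rewrite -{1}d -(bc x y).2 d; apply: eq_card => z.
  by rewrite !inE eqSS dist_eq1 // andbC.
Qed.

(** If m = 0, adjacency is transitive on distinct vertices, so that the
    connected graph is complete; otherwise any two non-adjacent vertices have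
    a common neighbour. *)
Lemma strongly_regular_diameter (G : sgraph) :
  connected_graph G -> strongly_regular G -> diameter G <= 2.
Proof.
move=> Gc [k [l [m [_ _ hm]]]].
apply/bigmax_leqP => x _; apply/bigmax_leqP => y _.
have [->|xy] := eqVneq x y.
  by rewrite distxx.
have [/dist_adj -> //|nxy] := boolP (adj x y).
have [m0|m_gt0] := posnP m; last first.
  move: m_gt0; rewrite -(hm x y) // => /card_gt0P[z]; rewrite !inE.
  move=> /andP[xz yz]; apply: (@dist_le_walk _ 2); apply: (@walk_cat _ 1 1 x z).
    by rewrite walk1.
  by rewrite walk1 adj_sym.
have tr (u v w : G) : adj u v -> adj v w -> u != w -> adj u w.
  move=> uv vw uw; apply: contraT => nuw.
  have := hm u w uw nuw; rewrite m0 => /cards0_eq/finset.setP/(_ v).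
  by rewrite !inE uv adj_sym vw.
case/negP: nxy; have [_ /(_ x y)/connectP[p]] := Gc.
elim: p x xy => [|z p IH] x xy /=; first by move=> _ e; rewrite e eqxx in xy.
move=> /andP[xz zp] e; have [zy|zy] := eqVneq z y; first by rewrite -zy.
exact: tr xz (IH z zy zp e) xy.
Qed.

(** * Matrices indexed by a finite type *)

Local Open Scope ring_scope.

Section Entries.
Variables (R : realType) (T : finType).
Implicit Types (M N : 'M[R]_#|T|) (x y : T).

Lemma entryP M N : (forall x y, entry M x y = entry N x y) -> M = N.
Proof.
move=> e; apply/matrixP => i j.
by have := e (enum_val i) (enum_val j); rewrite /entry !enum_valK.
Qed.

Lemma entry_mx_of f x y : entry (mx_of f) x y = f x y :> R.
Proof. by rewrite /entry mxE !enum_rankK. Qed.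

Lemma entryD M N x y : entry (M + N) x y = entry M x y + entry N x y.
Proof. by rewrite /entry mxE. Qed.

Lemma entryN M x y : entry (- M) x y = - entry M x y.
Proof. by rewrite /entry mxE. Qed.

Lemma entryZ c M x y : entry (c *: M) x y = c * entry M x y.
Proof. by rewrite /entry mxE. Qed.

Lemma entry1 x y : entry (1%:M : 'M[R]_#|T|) x y = (x == y)%:R.
Proof. by rewrite /entry mxE (inj_eq enum_rank_inj). Qed.

Lemma entryM M N x y : entry (M *m N) x y = \sum_z entry M x z * entry N z y.
Proof.
by rewrite /entry mxE (reindex enum_rank) //; apply/onW_bij/enum_rank_bij.
Qed.

Lemma entry_diag_mul P M x y :
  entry (diag_proj R P *m M) x y = (P x)%:R * entry M x y.
Proof.
rewrite entryM (bigD1 x) //= entry_mx_of eqxx big1 ?addr0 // => z zx.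
by rewrite entry_mx_of eq_sym (negbTE zx) mul0r.
Qed.

Lemma entry_mul_diag P M x y :
  entry (M *m diag_proj R P) x y = entry M x y * (P y)%:R.
Proof.
rewrite entryM (bigD1 y) //= entry_mx_of eqxx big1 ?addr0 // => z zy.
by rewrite entry_mx_of (negbTE zy) mulr0.
Qed.

Lemma diag_projC (P : pred T) : diag_proj R (predC P) = 1%:M - diag_proj R P.
Proof.
apply: entryP => x y; rewrite entryD entryN entry1 !entry_mx_of /=.
by case: (x == y); case: (P x); rewrite ?subrr ?subr0.
Qed.

End Entries.

(** * Unital subalgebras *)

Section Subalgebras.
Variables (R : realType) (n : nat) (S : set 'M[R]_n).
Hypothesis SA : unital_subalgebra S.

Lemma subalg1 : S 1%:M. Proof. by case: SA. Qed.

Lemma subalgM X Y : S X -> S Y -> S (X *m Y).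
Proof. by case: SA => _ _; apply. Qed.

Lemma subalgZD c X Y : S X -> S Y -> S (c *: X + Y).
Proof. by case: SA => _ SL _; apply: SL. Qed.

Lemma subalg0 : S 0.
Proof.
by have := subalgZD (-1) subalg1 subalg1; rewrite scaleN1r addNr.
Qed.

Lemma subalgD X Y : S X -> S Y -> S (X + Y).
Proof. by move=> SX SY; have := subalgZD 1 SX SY; rewrite scale1r. Qed.

Lemma subalgZ c X : S X -> S (c *: X).
Proof. by move=> SX; have := subalgZD c SX subalg0; rewrite addr0. Qed.

Lemma subalgB X Y : S X -> S Y -> S (X - Y).
Proof. by move=> SX SY; rewrite -scaleN1r; apply/subalgD/subalgZ. Qed.

End Subalgebras.

Lemma gen_algebra_subalgebra (R : realType) n (gens : set 'M[R]_n) :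
  unital_subalgebra (gen_algebra gens).
Proof.
split=> [S [[]] //|c X Y SX SY S SA|X Y SX SY S SA].
  by apply: (subalgZD SA.1); [apply: SX|apply: SY].
by apply: (subalgM SA.1); [apply: SX|apply: SY].
Qed.

Lemma gen_algebra_gen (R : realType) n (gens : set 'M[R]_n) X :
  gens X -> gen_algebra gens X.
Proof. exact: sub_gen_smallest. Qed.

(** * The all-ones matrix in the punctured algebra *)

Section Root.
Variables (R : realType) (G : sgraph) (a : G).
Local Notation V := (del_vertex a).
Local Notation B := (adj_mx R V).
Local Notation E := (nbr_proj R a).
Local Notation F := (diag_proj R (fun x : V => ~~ adj a (val x))).
Local Notation J := (const_mx 1 : 'M[R]_#|V|).
Local Notation alg := (punctured_algebra R a).

Lemma entryJ (x y : V) : entry J x y = 1.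
Proof. by rewrite /entry mxE. Qed.

Lemma sum_del_vertex (f : G -> R) :
  \sum_z f z = f a + \sum_(z : V) f (val z).
Proof.
by rewrite (bigD1 a) //=; congr (_ + _); rewrite (big_sub (predC1 a)).
Qed.

Let algA : unital_subalgebra alg := gen_algebra_subalgebra _.

Lemma punctured_adj : alg B.
Proof. by apply: gen_algebra_gen; left; right. Qed.

Lemma punctured_nbr : alg E.
Proof. by apply: gen_algebra_gen; right. Qed.

Lemma punctured_nonnbr : alg F.
Proof.
rewrite (diag_projC _ (fun x : V => adj a (val x))).
exact: (subalgB algA (subalg1 algA) punctured_nbr).
Qed.

(** The strongly regular identity with a deleted: entry (x, y) of B^2 counts
    the common neighbours of x and y other than a, and a is a common neighbour
    exactly when x and y both lie in N(a), that is, at the ones of E J E. *)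
Lemma punctured_sqr_adj (k l m : nat) :
  (forall x : G, #|[set z | adj x z]%SET| = k) ->
  (forall x y : G, adj x y -> #|[set z | adj x z & adj y z]%SET| = l) ->
  (forall x y : G, x != y -> ~~ adj x y ->
     #|[set z | adj x z & adj y z]%SET| = m) ->
  B *m B - (k%:R - m%:R) *: 1%:M - (l%:R - m%:R) *: B
    = m%:R *: J - E *m J *m E.
Proof.
move=> hk hl hm; apply: entryP => x y.
rewrite !(entryD, entryN, entryZ) entryM entry1 entryJ entry_mul_diag.
rewrite entry_diag_mul entryJ !entry_mx_of !mulr1.
under eq_bigr => z _ do rewrite !entry_mx_of.
have := sum_del_vertex (fun z => (adj (val x) z)%:R * (adj z (val y))%:R).
rewrite /= => /esym/eqP; rewrite addrC eq_sym -subr_eq => /eqP <-.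
have -> : \sum_z (adj (val x) z)%:R * (adj z (val y))%:R
    = #|[set z | adj (val x) z & adj (val y) z]%SET|%:R :> R.
  rewrite -sum1_card natr_sum [RHS]big_mkcond; apply: eq_bigr => z _.
  by rewrite inE (adj_sym z) -natrM mulnb; case: (_ && _).
rewrite (adj_sym (val x) a); set P := (_%:R * _ : R).
have -> : del_adj x y = adj (val x) (val y) by [].
have [->|xy] := eqVneq x y.
  rewrite adj_irr; have -> : #|[set z | adj (val y) z & adj (val y) z]%SET| = k.
    by rewrite -(hk (val y)); apply: eq_card => z; rewrite !inE andbb.
  by rewrite mulr0 subr0 mulr1; ring.
have vxy : val x != val y by [].
have [axy|naxy] := boolP (adj (val x) (val y)).
  by rewrite (hl _ _ axy) mulr0 mulr1; ring.
by rewrite (hm _ _ vxy naxy) !mulr0; ring.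
Qed.

(** Multiplying m J - E J E by the projection F onto the non-neighbours of a
    isolates m F J and m J F, and (J F)(F J) is J times the number of
    non-neighbours of a.  If G is not complete, then m is nonzero because two
    non-adjacent vertices have a common neighbour, and a has a non-neighbour
    because all vertices have the same degree. *)
Lemma punctured_all_ones :
  connected_graph G -> strongly_regular G -> (diameter G <= 2)%N -> alg J.
Proof.
move=> Gc [k [l [m [hk hl hm]]]] d2.
have [Gcomp|] := boolP [forall x : G, forall y : G, (x != y) ==> adj x y].
  have -> : J = 1%:M + B.
    apply: entryP => x y; rewrite entryD entryJ entry1 entry_mx_of /=.
    have [->|xy] := eqVneq x y; first by rewrite del_adj_irr addr0.
    have vxy : val x != val y by [].
    have -> : del_adj x y by exact: implyP (forallP (forallP Gcomp _) _) vxy.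
    by rewrite add0r.
  exact: (subalgD algA (subalg1 algA) punctured_adj).
rewrite negb_forall => /existsP[x]; rewrite negb_forall => /existsP[y].
rewrite negb_imply => /andP[xy nxy].
have m0 : m%:R != 0 :> R.
  have [z xz yz] := common_neighbour Gc d2 xy nxy.
  rewrite pnatr_eq0 -lt0n -(hm x y) //; apply/card_gt0P; exists z.
  by rewrite inE xz.
pose FJ : 'M[R]_#|V| := mx_of (fun u v : V => (~~ adj a (val u))%:R).
pose JF : 'M[R]_#|V| := mx_of (fun u v : V => (~~ adj a (val v))%:R).
pose n2 := \sum_(u : V) (~~ adj a (val u))%:R : R.
have n20 : n2 != 0.
  have [u ua nau] : exists2 u, u != a & ~~ adj a u.
    apply/exists_inP; apply: contraT; rewrite negb_exists_in => /forall_inP h.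
    (* Otherwise a has degree #|G| - 1, but the neighbourhood of x misses y
       as well as x. *)
    have : (#|[set z | adj a z]%SET| <= #|[set~ x] :\ y|)%N.
      rewrite hk -(hk x); apply/subset_leq_card/fintype.subsetP => z.
      rewrite !inE => xz; apply/andP; split; apply: contraTneq xz => ->//.
      by rewrite adj_irr.
    have -> : [set z | adj a z]%SET = [set~ a].
      apply/finset.setP => z; rewrite !inE; apply/idP/idP.
        by apply: contraTneq => ->; rewrite adj_irr.
      by move=> /h; rewrite negbK.
    rewrite leqNgt => /negP[]; rewrite cardsC1 -(cardsC1 x).
    by apply/proper_card/properD1; rewrite !inE eq_sym.
  rewrite /n2 (bigD1 (exist _ u ua : V)) //= nau lt0r_neq0 //.
  by rewrite ltr_wpDr // sumr_ge0.
pose Q := B *m B - (k%:R - m%:R) *: 1%:M - (l%:R - m%:R) *: B.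
have algQ : alg Q.
  apply: (subalgB algA); last exact: (subalgZ algA _ punctured_adj).
  apply: (subalgB algA); last exact: (subalgZ algA _ (subalg1 algA)).
  exact: (subalgM algA punctured_adj punctured_adj).
have algFJ : alg FJ.
  have -> : FJ = m%:R^-1 *: (F *m Q).
    rewrite /Q (punctured_sqr_adj hk hl hm); apply: entryP => u v.
    rewrite entryZ entry_diag_mul entryD entryN entry_mul_diag entry_diag_mul.
    rewrite entryZ !entryJ entry_mx_of !mulr1; case: (adj a (val u)) => /=.
      by rewrite mul0r mulr0.
    by rewrite !mul0r subr0 mul1r mulVf.
  exact: (subalgZ algA _ (subalgM algA punctured_nonnbr algQ)).
have algJF : alg JF.
  have -> : JF = m%:R^-1 *: (Q *m F).
    rewrite /Q (punctured_sqr_adj hk hl hm); apply: entryP => u v.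
    rewrite entryZ entry_mul_diag entryD entryN entry_mul_diag entry_diag_mul.
    rewrite entryZ !entryJ entry_mx_of !mulr1; case: (adj a (val v)) => /=.
      by rewrite !mulr0.
    by rewrite !mulr0 subr0 mulr1 mulVf.
  exact: (subalgZ algA _ (subalgM algA algQ punctured_nonnbr)).
have -> : J = n2^-1 *: (JF *m FJ).
  apply: entryP => u v; rewrite entryZ entryM entryJ.
  under eq_bigr => z _.
    rewrite !entry_mx_of -natrM mulnb andbb. over.
  by rewrite mulVf.
exact: (subalgZ algA _ (subalgM algA algJF algFJ)).
Qed.

(** * The compressed Terwilliger algebra *)

Local Notation T := (terwilliger R a).
Local Notation e := (corner_idem R a).

Let algT : unital_subalgebra T := gen_algebra_subalgebra _.

Lemma entry_delete (M : 'M[R]_#|G|) (x y : V) :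
  entry (delete_mx a M) x y = entry M (val x) (val y).
Proof. exact: entry_mx_of. Qed.

Lemma corner_idemE : e = diag_proj R (fun x => x != a).
Proof.
rewrite /corner_idem /dual_idem.
have -> : diag_proj R (fun x => dist a x == 0) = diag_proj R (fun x => x == a).
  by apply: entryP => x y; rewrite !entry_mx_of dist_eq0 (eq_sym a).
by rewrite -(diag_projC _ (fun x => x == a)).
Qed.

Lemma delete_corner (M : 'M[R]_#|G|) :
  delete_mx a (e *m M *m e) = delete_mx a M.
Proof.
apply: entryP => x y; rewrite !entry_delete corner_idemE entry_mul_diag.
by rewrite entry_diag_mul !del_vertex_neq mul1r mulr1.
Qed.

Lemma compressed_terwilligerE :
  compressed_terwilliger R a = (delete_mx a @` T)%classic.
Proof.
apply/seteqP; split=> M.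
  by move=> [_ [X TX <-] <-]; exists X; rewrite ?delete_corner.
move=> [X TX <-]; exists (e *m X *m e); last exact: delete_corner.
by exists X.
Qed.

(** Beyond the eccentricity of a the projections vanish. *)
Lemma terwilliger_dual_idem i : T (dual_idem R a i).
Proof.
have [i_ecc|ecc_i] := leqP i (ecc a).
  by apply: gen_algebra_gen; right; exists i.
suff -> : dual_idem R a i = 0 by apply: subalg0 algT.
apply: entryP => x y; rewrite entry_mx_of [RHS]mxE.
by rewrite (ltn_eqF (leq_ltn_trans (dist_le_ecc a x) ecc_i)) andbF.
Qed.

(** Deletion is multiplicative only once the walks through a are cut out by
    the corner idempotent. *)
Lemma delete_mxM (M N : 'M[R]_#|G|) :
  delete_mx a (M *m (e *m N)) = delete_mx a M *m delete_mx a N.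
Proof.
apply: entryP => x y; rewrite entry_delete !entryM sum_del_vertex.
rewrite corner_idemE entry_diag_mul eqxx mul0r mulr0 add0r.
apply: eq_bigr => z _.
by rewrite !entry_delete entry_diag_mul del_vertex_neq mul1r.
Qed.

Lemma terwilliger_corner : T e.
Proof.
exact: (subalgB algT (subalg1 algT) (terwilliger_dual_idem 0)).
Qed.

Lemma compressed_subalgebra : unital_subalgebra (compressed_terwilliger R a).
Proof.
rewrite compressed_terwilligerE; split.
- exists 1%:M; first exact: subalg1 algT.
  by apply: entryP => x y; rewrite entry_delete !entry1.
- move=> c _ _ [X TX <-] [Y TY <-]; exists (c *: X + Y).
    exact: (subalgZD algT).
  by apply: entryP => x y; rewrite !(entry_delete, entryD, entryZ).
- move=> _ _ [X TX <-] [Y TY <-]; exists (X *m (e *m Y)).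
    exact: (subalgM algT TX (subalgM algT terwilliger_corner TY)).
  exact: delete_mxM.
Qed.

Lemma delete_adj : delete_mx a (adj_mx R G) = B.
Proof. by apply: entryP => x y; rewrite entry_delete !entry_mx_of. Qed.

Hypothesis Gc : connected_graph G.

Lemma delete_dual_idem1 : delete_mx a (dual_idem R a 1) = E.
Proof.
by apply: entryP => x y; rewrite entry_delete !entry_mx_of dist_eq1.
Qed.

Lemma punctured_sub_compressed : (alg `<=` compressed_terwilliger R a)%classic.
Proof.
apply: smallest_sub; first exact: compressed_subalgebra.
move=> _ [[->|->]|->].
- exact: subalg1 compressed_subalgebra.
- rewrite compressed_terwilligerE; exists (adj_mx R G); last exact: delete_adj.
  by apply: gen_algebra_gen; left.
- rewrite compressed_terwilligerE; exists (dual_idem R a 1).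
    exact: terwilliger_dual_idem.
  exact: delete_dual_idem1.
Qed.

(** * Every Terwilliger matrix has its blocks in the punctured algebra *)

(** The row and column of M at a, repeated so as to become matrices on G - a;
    they are the outer products of that row and column with the all-ones
    vector. *)
Definition row_spread (M : 'M[R]_#|G|) : 'M[R]_#|V| :=
  mx_of (fun x y : V => entry M a (val y)).

Definition col_spread (M : 'M[R]_#|G|) : 'M[R]_#|V| :=
  mx_of (fun x y : V => entry M (val x) a).

(** The condition on the border of M, and not just on the block off a, is what
    makes it stable under products. *)
Definition bordered (M : 'M[R]_#|G|) : Prop :=
  [/\ alg (delete_mx a M), alg (row_spread M) & alg (col_spread M)].

Lemma bordered_subalgebra : unital_subalgebra bordered.
Proof.
split.
- split.
  + have -> : delete_mx a 1%:M = 1%:M :> 'M[R]_#|V|.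
      by apply: entryP => x y; rewrite entry_delete !entry1.
    exact: subalg1 algA.
  + have -> : row_spread 1%:M = 0.
      apply: entryP => x y; rewrite entry_mx_of entry1 [RHS]mxE eq_sym.
      by rewrite (negbTE (del_vertex_neq y)).
    exact: subalg0 algA.
  + have -> : col_spread 1%:M = 0.
      apply: entryP => x y; rewrite entry_mx_of entry1 [RHS]mxE.
      by rewrite (negbTE (del_vertex_neq x)).
    exact: subalg0 algA.
- move=> c X Y [X1 X2 X3] [Y1 Y2 Y3]; split.
  + have -> : delete_mx a (c *: X + Y) = c *: delete_mx a X + delete_mx a Y.
      by apply: entryP => x y; rewrite !(entry_delete, entryD, entryZ).
    exact: (subalgZD algA).
  + have -> : row_spread (c *: X + Y) = c *: row_spread X + row_spread Y.
      by apply: entryP => x y; rewrite !(entry_mx_of, entryD, entryZ).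
    exact: (subalgZD algA).
  + have -> : col_spread (c *: X + Y) = c *: col_spread X + col_spread Y.
      by apply: entryP => x y; rewrite !(entry_mx_of, entryD, entryZ).
    exact: (subalgZD algA).
- move=> X Y [X1 X2 X3] [Y1 Y2 Y3]; split.
  (* The walks through a contribute the outer product of a column and a row;
     the product of the repeated matrices is #|V| times that. *)
  + have -> : delete_mx a (X *m Y) =
        #|V|%:R^-1 *: (col_spread X *m row_spread Y)
        + delete_mx a X *m delete_mx a Y.
      apply: entryP => x y; rewrite entry_delete entryD entryZ !entryM.
      rewrite sum_del_vertex; congr (_ + _); last first.
        by apply: eq_bigr => z _; rewrite !entry_delete.
      under eq_bigr => z _ do rewrite !entry_mx_of.
      rewrite sumr_const -(mulr_natl (_ * _)) mulKf // pnatr_eq0 -lt0n.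
      by apply/card_gt0P; exists x.
    exact: (subalgZD algA _ (subalgM algA _ _) (subalgM algA _ _)).
  + have -> : row_spread (X *m Y)
        = entry X a a *: row_spread Y + row_spread X *m delete_mx a Y.
      apply: entryP => x y; rewrite entry_mx_of entryD entryZ !entryM.
      rewrite sum_del_vertex entry_mx_of; congr (_ + _).
      by apply: eq_bigr => z _; rewrite !entry_mx_of.
    exact: (subalgZD algA _ _ (subalgM algA _ _)).
  + have -> : col_spread (X *m Y)
        = entry Y a a *: col_spread X + delete_mx a X *m col_spread Y.
      apply: entryP => x y; rewrite entry_mx_of entryD entryZ !entryM.
      rewrite sum_del_vertex entry_mx_of mulrC; congr (_ + _).
      by apply: eq_bigr => z _; rewrite !entry_mx_of.
    exact: (subalgZD algA _ _ (subalgM algA _ _)).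
Qed.

Lemma bordered_adj : alg J -> bordered (adj_mx R G).
Proof.
move=> algJ; split.
- by rewrite delete_adj; apply: punctured_adj.
- have -> : row_spread (adj_mx R G) = J *m E.
    by apply: entryP => x y; rewrite entry_mul_diag entryJ !entry_mx_of mul1r.
  exact: (subalgM algA algJ punctured_nbr).
- have -> : col_spread (adj_mx R G) = E *m J.
    apply: entryP => x y; rewrite entry_diag_mul entryJ !entry_mx_of mulr1.
    by rewrite adj_sym.
  exact: (subalgM algA punctured_nbr algJ).
Qed.

Lemma bordered_dual_idem i : (diameter G <= 2)%N -> bordered (dual_idem R a i).
Proof.
move=> d2; split.
- have [->|i1] := eqVneq i 1.
    by rewrite delete_dual_idem1; apply: punctured_nbr.
  have [->|i2] := eqVneq i 2.
    have -> : delete_mx a (dual_idem R a 2) = F.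
      apply: entryP => x y; rewrite entry_delete !entry_mx_of -dist_eq1 //.
      have := leq_trans (dist_le_diameter a (val x)) d2.
      have : (0 < dist a (val x))%N by rewrite dist_gt0 eq_sym del_vertex_neq.
      by case: (dist a (val x)) => [|[|[]]].
    exact: punctured_nonnbr.
  have -> : delete_mx a (dual_idem R a i) = 0; last exact: subalg0 algA.
  apply: entryP => x y; rewrite entry_delete entry_mx_of [RHS]mxE.
  have := leq_trans (dist_le_diameter a (val x)) d2.
  have : (0 < dist a (val x))%N by rewrite dist_gt0 eq_sym del_vertex_neq.
  move: i1 i2; rewrite !(eq_sym i) => i1 i2.
  by case: (dist a (val x)) => [|[|[]]] //;
    rewrite ?(negbTE i1) ?(negbTE i2) andbF.
- have -> : row_spread (dual_idem R a i) = 0; last exact: subalg0 algA.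
  apply: entryP => x y; rewrite !entry_mx_of [RHS]mxE.
  by rewrite eq_sym (negbTE (del_vertex_neq y)).
- have -> : col_spread (dual_idem R a i) = 0; last exact: subalg0 algA.
  apply: entryP => x y; rewrite !entry_mx_of [RHS]mxE.
  by rewrite (negbTE (del_vertex_neq x)).
Qed.

Lemma punctured_eq_compressed :
  strongly_regular G -> (diameter G <= 2)%N ->
  alg = compressed_terwilliger R a.
Proof.
move=> Gsr d2; apply/seteqP; split; first exact: punctured_sub_compressed.
rewrite compressed_terwilligerE => _ [X TX <-].
suff [] : bordered X by [].
move: X TX; apply: smallest_sub; first exact: bordered_subalgebra.
move=> _ [->|[i _ <-]]; last exact: bordered_dual_idem.
by apply: bordered_adj; apply: punctured_all_ones.
Qed.

End Root.

Theorem corollary6p2 (R : realType) :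
  (forall G : sgraph, distance_regular G -> (0 < diameter G)%N ->
     (forall a : G, connected_graph (del_vertex a)) /\
     ((diameter G <= 2)%N ->
        forall a : G, punctured_algebra R a = compressed_terwilliger R a)) /\
  (forall G : sgraph, connected_graph G -> strongly_regular G ->
     ~ complete_graph G -> ~ edgeless_graph G ->
     forall a : G, punctured_algebra R a = compressed_terwilliger R a).
Proof.
split=> [G Gdr dG|G Gc Gsr _ _ a].
  split=> [a|d2 a]; first exact: del_vertex_connected.
  apply: punctured_eq_compressed => //; first by case: Gdr.
  exact: distance_regular_strongly_regular.
apply: punctured_eq_compressed => //; exact: strongly_regular_diameter.
Qed.
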